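(* Let $G$ be a group and $H$ a subgroup of $G$. Then there exists an $E$-unitary special inverse monoid $M$ such that for every finite subset $X\subseteq G$, the setwise stabiliser in $G$ of the union $XH$ of the left $H$-cosets determined by $X$, $$K=\{g\in G\mid gXH=XH\},$$ is isomorphic to a group $\mathcal{H}$-class in $M$. If $G$ is finitely presented and $H$ is finitely generated, then $M$ can be chosen to be finitely presented (by a special inverse monoid presentation) with the same number of defining relations as $G$ (unless $G$ is free, in which case $M$ will have $1$ defining relation). If $H$ is trivial, then $M$ can be chosen to be the free product of $G$ with a free inverse monoid.
   Context: An inverse monoid is a monoid $M$ in which every $m\in M$ has a unique inverse $m^{-1}$ with $mm^{-1}m=m$ and $m^{-1}mm^{-1}=m^{-1}$. For an alphabet $A$ with formal inverses $A^{-1}$ and $A^{\pm1}=A\cup A^{-1}$, $\mathrm{Inv}\langle A\rangle$ denotes the free inverse monoid on $A$ (the quotient of the free monoid $(A^{\pm1})^*$ by the congruence generated by $ww^{-1}w=w$ and $uu^{-1}ww^{-1}=ww^{-1}uu^{-1}$ for all words $u,w$), and $\mathrm{Inv}\langle A\mid R\rangle$ is its quotient by the congruence generated by $R\subseteq (A^{\pm1})^*\times(A^{\pm1})^*$. The presentation is special if every relation has the form $w=1$; an inverse monoid is special if it admits a special presentation (alphabets and sets of relations are not assumed finite unless stated). The maximal group image of $M=\mathrm{Inv}\langle A\mid R\rangle$ is the group $\mathrm{Gp}\langle A\mid R\rangle$, with canonical surjection $\sigma:M\to \mathrm{Gp}\langle A\mid R\rangle$; $M$ is $E$-unitary if $\sigma^{-1}(1)$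 is exactly the set of idempotents of $M$. Elements $m,n\in M$ are $\mathcal{H}$-related if $mm^{-1}=nn^{-1}$ and $m^{-1}m=n^{-1}n$. A group $\mathcal{H}$-class (maximal subgroup) of $M$ is the $\mathcal{H}$-class $H_e$ of an idempotent $e\in M$; it is a group with identity $e$. Here $XH=\{xh\mid x\in X,\ h\in H\}$. The free product is the free product in the category of inverse monoids. ''The same number of defining relations as $G$'' refers to the number of defining relations in a finite group presentation for $G$: given such a presentation with $k$ relations, $M$ has a finite special inverse monoid presentation with $k$ relations. *)

(* Defs.v *)
From HB Require Import structures.
From mathcomp Require Import all_boot.
From mathcomp Require Import mathcomp_extra boolp classical_sets functions.
From mathcomp Require Import cardinality.

Set Implicit Arguments.
Unset Strict Implicit.
Unset Printing Implicit Defensive.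

Local Open Scope classical_set_scope.
Local Open Scope group_scope.
Local Open Scope quotient_scope.

(* The starMonoidType axioms (x |-> x^-1 is an involutive anti-automorphism)
   are consequences of the uniqueness of inverses, so they add no restriction. *)
Definition inverse_monoid (M : starMonoidType) : Prop :=
  forall m n : M, (m * n * m = m /\ n * m * n = n) <-> n = m^-1.

Lemma group_inverse_monoid (G : groupType) : inverse_monoid G.
Proof.
move=> m n; split=> [[mnm _]|->]; last by rewrite mulgV mul1g mulVg mul1g.
apply: (mulgI m); apply: (mulIg m).
by rewrite mnm mulgV mul1g.
Qed.

Section Green.
Variable M : starMonoidType.

Definition idempotents : set M := [set e | e * e = e].

Definition Hrel (m n : M) : Prop :=
  m * m^-1 = n * n^-1 /\ m^-1 * m = n^-1 * n.

Definition Hclass (e : M) : set M := [set m | Hrel m e].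
End Green.

Definition isomorphic (M N : monoidType) : Prop :=
  exists f : M -> N, bijective f /\ monoid_morphism f.

(* Inverse monoids form a category with monoid morphisms as arrows (these
   preserve inverses); the free product is the coproduct there. *)
Definition is_free_product (M1 M2 M : starMonoidType)
    (i1 : M1 -> M) (i2 : M2 -> M) : Prop :=
  [/\ inverse_monoid M, monoid_morphism i1, monoid_morphism i2 &
      forall (N : starMonoidType) (f1 : M1 -> N) (f2 : M2 -> N),
        inverse_monoid N -> monoid_morphism f1 -> monoid_morphism f2 ->
        exists! f : M -> N,
          [/\ monoid_morphism f, f \o i1 =1 f1 & f \o i2 =1 f2]].

(* The letter (a, false) stands for a, and (a, true) for its formal inverse. *)
Notation word A := (seq (A * bool)).

Definition winv (A : Type) (w : word A) : word A :=
  rev [seq (x.1, ~~ x.2) | x <- w].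

Section WordQuotient.
Variable A : choiceType.
Implicit Types (T : word A -> word A -> Prop) (u v w : word A).

Inductive congr_gen T : word A -> word A -> Prop :=
| congr_base u v : T u v -> congr_gen T u v
| congr_refl u : congr_gen T u u
| congr_sym u v : congr_gen T u v -> congr_gen T v u
| congr_trans u v w : congr_gen T u v -> congr_gen T v w -> congr_gen T u w
| congr_cat u u' v v' :
    congr_gen T u u' -> congr_gen T v v' -> congr_gen T (u ++ v) (u' ++ v').

Variable T : word A -> word A -> Prop.

Definition congrb : rel (word A) := fun u v => `[< congr_gen T u v >].

Lemma congrb_refl : reflexive congrb.
Proof. by move=> u; apply/asboolP; apply: congr_refl. Qed.

Lemma congrb_sym : symmetric congrb.
Proof. by move=> u v; apply/asboolP/asboolP; apply: congr_sym. Qed.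

Lemma congrb_trans : transitive congrb.
Proof.
by move=> v u w /asboolP uv /asboolP vw; apply/asboolP; apply: congr_trans uv vw.
Qed.

Canonical congrb_equiv := EquivRel congrb congrb_refl congrb_sym congrb_trans.

Definition wquot := {eq_quot congrb}.
HB.instance Definition _ := Choice.on wquot.
HB.instance Definition _ := EqQuotient.on wquot.

Lemma wquotP u v : \pi_wquot u = \pi_wquot v <-> congr_gen T u v.
Proof.
split=> [/eqmodP/asboolP //|uv]; by apply/eqmodP/asboolP.
Qed.

Definition wq_mul (x y : wquot) : wquot := \pi_wquot (repr x ++ repr y).
Definition wq_one : wquot := \pi_wquot [::].

Lemma repr_congr u : congr_gen T (repr (\pi_wquot u)) u.
Proof. by apply/wquotP; rewrite reprK. Qed.

Lemma wquot_surj (x : wquot) : exists u, x = \pi_wquot u.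
Proof. by exists (repr x); rewrite reprK. Qed.

Lemma wq_mul_pi u v : wq_mul (\pi_wquot u) (\pi_wquot v) = \pi_wquot (u ++ v).
Proof. by apply/wquotP/congr_cat; apply: repr_congr. Qed.

Lemma wq_mulA : associative wq_mul.
Proof.
move=> x y z; case: (wquot_surj x) (wquot_surj y) => u -> [v ->].
by case: (wquot_surj z) => w ->; rewrite !wq_mul_pi catA.
Qed.

Lemma wq_mul1 : left_id wq_one wq_mul.
Proof. by move=> x; case: (wquot_surj x) => u ->; rewrite wq_mul_pi. Qed.

Lemma wq_mulr1 : right_id wq_one wq_mul.
Proof. by move=> x; case: (wquot_surj x) => u ->; rewrite wq_mul_pi cats0. Qed.

HB.instance Definition _ := isMonoid.Build wquot wq_mulA wq_mul1 wq_mulr1.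

Lemma pi_cat u v : \pi_wquot (u ++ v) = \pi_wquot u * \pi_wquot v.
Proof. by rewrite -wq_mul_pi. Qed.

Lemma pi_nil : \pi_wquot [::] = 1.
Proof. by []. Qed.

End WordQuotient.

Lemma winvK (A : Type) : involutive (@winv A).
Proof.
move=> w; rewrite /winv map_rev revK -map_comp -[RHS]map_id.
by apply: eq_map => -[a b] /=; rewrite negbK.
Qed.

Lemma winv_cat (A : Type) (u v : word A) : winv (u ++ v) = winv v ++ winv u.
Proof. by rewrite /winv map_cat rev_cat. Qed.

Section Presentations.
Variable A : choiceType.
Implicit Types (R : set (word A * word A)) (u v w : word A).

Inductive inv_rel R : word A -> word A -> Prop :=
| inv_rel_regular w : inv_rel R (w ++ winv w ++ w) w
| inv_rel_commute u w :
    inv_rel R (u ++ winv u ++ w ++ winv w) (w ++ winv w ++ u ++ winv u)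
| inv_rel_relation u v : R (u, v) -> inv_rel R u v.

Inductive gp_rel R : word A -> word A -> Prop :=
| gp_rel_cancel w : gp_rel R (w ++ winv w) [::]
| gp_rel_relation u v : R (u, v) -> gp_rel R u v.

Variable R : set (word A * word A).

Definition invPres := wquot (inv_rel R).
HB.instance Definition _ := Monoid.on invPres.
HB.instance Definition _ := EqQuotient.on invPres.

Definition gpPres := wquot (gp_rel R).
HB.instance Definition _ := Monoid.on gpPres.
HB.instance Definition _ := EqQuotient.on gpPres.

Definition invPres_inv (x : invPres) : invPres := \pi_invPres (winv (repr x)).
Definition gpPres_inv (x : gpPres) : gpPres := \pi_gpPres (winv (repr x)).

Notation ip := (\pi_invPres).
Notation gp := (\pi_gpPres).

Lemma ip_cat u v : ip (u ++ v) = ip u * ip v.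
Proof. exact: pi_cat. Qed.

Lemma gp_cat u v : gp (u ++ v) = gp u * gp v.
Proof. exact: pi_cat. Qed.

Lemma ip_surj (x : invPres) : exists u, x = ip u.
Proof. by exists (repr x); rewrite reprK. Qed.

Lemma ip_regular w : ip w * ip (winv w) * ip w = ip w.
Proof.
rewrite -!ip_cat -catA; apply/wquotP.
apply: congr_base; exact: inv_rel_regular.
Qed.

Lemma ip_commute u w :
  ip u * ip (winv u) * (ip w * ip (winv w)) =
  ip w * ip (winv w) * (ip u * ip (winv u)).
Proof.
rewrite -!ip_cat -!catA; apply/wquotP.
apply: congr_base; exact: inv_rel_commute.
Qed.

Lemma ip_winv u v : ip u = ip v -> ip (winv u) = ip (winv v).
Proof.
move=> uv; set a := ip u; set x := ip (winv u); set y := ip (winv v).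
have axa : a * x * a = a by apply: ip_regular.
have aya : a * y * a = a by rewrite /a uv; apply: ip_regular.
have xax : x * a * x = x by have := ip_regular (winv u); rewrite winvK.
have yay : y * a * y = y.
  by have := ip_regular (winv v); rewrite winvK -uv.
have cr : a * x * (a * y) = a * y * (a * x).
  by have := ip_commute u v; rewrite -uv.
have cl : x * a * (y * a) = y * a * (x * a).
  by have := ip_commute (winv u) (winv v); rewrite !winvK -uv.
have -> : x = x * a * y.
  rewrite -[LHS]xax -[in LHS]aya -!mulgA (mulgA a y) (mulgA (a * y)).
  by rewrite -(mulgA (a * y)) -cr !mulgA xax.
rewrite -[in LHS]yay !mulgA -(mulgA (x * a)) cl !mulgA -!(mulgA y).
by rewrite axa mulgA yay.
Qed.

Lemma invPres_inv_pi u : invPres_inv (ip u) = ip (winv u).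
Proof. by apply: ip_winv; rewrite reprK. Qed.

Lemma invPres_invK : involutive invPres_inv.
Proof.
by move=> x; case: (ip_surj x) => u ->; rewrite !invPres_inv_pi winvK.
Qed.

Lemma invPres_invM :
  {morph invPres_inv : x y / (x : invPres) * y >-> y * x}.
Proof.
move=> x y; case: (ip_surj x) (ip_surj y) => u -> [v ->].
by rewrite -ip_cat !invPres_inv_pi winv_cat ip_cat.
Qed.

HB.instance Definition _ := hasInv.Build invPres invPres_inv.
HB.instance Definition _ :=
  Monoid_isStarMonoid.Build invPres invPres_invK invPres_invM.

Lemma invPres_regular (x : invPres) : x * x^-1 * x = x.
Proof. by case: (ip_surj x) => u ->; rewrite [_^-1]invPres_inv_pi ip_regular. Qed.

Lemma invPres_commute (x y : invPres) :
  x * x^-1 * (y * y^-1) = y * y^-1 * (x * x^-1).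
Proof.
case: (ip_surj x) (ip_surj y) => u -> [v ->].
by rewrite ![_^-1]invPres_inv_pi ip_commute.
Qed.

Lemma invPres_idem (e : invPres) : e * e = e -> e = e * e^-1.
Proof.
move=> ee; suff eV : e^-1 = e by rewrite eV ee.
have eVE : e^-1 = e^-1 * e * (e * e^-1).
  rewrite mulgA -(mulgA e^-1) ee.
  by have := invPres_regular e^-1; rewrite invgK.
rewrite -[RHS]invgK [in RHS]eVE !invgM !invgK.
by rewrite {1}eVE; have := invPres_commute e^-1 e; rewrite invgK.
Qed.

Lemma invPres_inverse_monoid : inverse_monoid invPres.
Proof.
move=> m n.
have VgV (x : invPres) : x^-1 * x * x^-1 = x^-1.
  by have := invPres_regular x^-1; rewrite invgK.
split=> [[mnm nmn]|->]; last by rewrite invPres_regular VgV.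
have idc (e f : invPres) : e * e = e -> f * f = f -> e * f = f * e.
  by move=> /invPres_idem -> /invPres_idem ->; apply: invPres_commute.
have cr : m * n * (m * m^-1) = m * m^-1 * (m * n).
  by apply: idc; rewrite mulgA ?mnm ?invPres_regular.
have cl : n * m * (m^-1 * m) = m^-1 * m * (n * m).
  by apply: idc; rewrite mulgA ?nmn ?VgV.
have -> : n = n * m * m^-1.
  rewrite -[LHS]nmn -{1}(invPres_regular m) -!mulgA (mulgA m m^-1).
  by rewrite -cr !mulgA nmn.
rewrite -[in LHS]VgV !mulgA -(mulgA (n * m)) cl.
by rewrite -!mulgA (mulgA n) (mulgA m (n * m)) (mulgA m n) mnm !mulgA VgV.
Qed.

Lemma gp_mulwV w : gp w * gp (winv w) = 1.
Proof.
by rewrite -gp_cat; apply/wquotP; apply: congr_base; exact: gp_rel_cancel.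
Qed.

Lemma gp_mulVw w : gp (winv w) * gp w = 1.
Proof. by have := gp_mulwV (winv w); rewrite winvK. Qed.

HB.instance Definition _ := hasInv.Build gpPres gpPres_inv.

Lemma gpPres_mulVg : left_inverse 1 gpPres_inv (@mul gpPres).
Proof. by move=> x; rewrite -{2}[x]reprK gp_mulVw. Qed.

Lemma gpPres_mulgV : right_inverse 1 gpPres_inv (@mul gpPres).
Proof. by move=> x; rewrite -{1}[x]reprK gp_mulwV. Qed.

HB.instance Definition _ :=
  Monoid_isGroup.Build gpPres gpPres_mulVg gpPres_mulgV.

Definition sigma (m : invPres) : gpPres := \pi_gpPres (repr m).

(* sigma does not depend on the representative: it sends the class of a word
   in Inv<A|R> to the class of the same word in Gp<A|R>. *)
Lemma sigma_pi u : sigma (ip u) = gp u.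
Proof.
have cong v w : congr_gen (inv_rel R) v w -> gp v = gp w.
  elim=> {v w} [v w|//|//|v w t _ -> //|v v' w w' _ + _].
  - case=> [{}w|{}v {}w|{}v {}w vw].
    + by rewrite !gp_cat gp_mulVw mulg1.
    + rewrite catA [in RHS]catA.
      by rewrite !gp_cat !(mulgA, gp_mulwV, mul1g).
    + by apply/wquotP; apply: congr_base; exact: gp_rel_relation.
  - by rewrite !gp_cat => -> ->.
by apply/cong/wquotP; rewrite reprK.
Qed.

Definition E_unitary : Prop := sigma @^-1` [set 1] = @idempotents invPres.

Definition special : Prop := forall u v, R (u, v) -> v = [::].

End Presentations.

Definition is_free_group (G : groupType) : Prop :=
  exists B : choiceType, isomorphic (@gpPres B set0) G.

Section Subsets.
Variable G : groupType.
Implicit Types (H X Y : set G).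

Definition subgroup H : Prop := group_closed [in H].

Definition finitely_generated H : Prop :=
  exists2 Y : set G, finite_set Y & H = smallest subgroup Y.

Definition setwise_stab Y : set G := [set g | [set g * y | y in Y] = Y].

Definition stabs_are_Hclasses H (M : starMonoidType) : Prop :=
  forall X, finite_set X ->
  let K := setwise_stab [set x * h | x in X & h in H] in
  exists (e : M) (f : G -> M),
    [/\ idempotents e, set_bij K (Hclass e) f &
        {in K &, {morph f : x y / x * y}}].

End Subsets.

(* Main.v *)
(* Let M be generated by a group of units G and letters t_i such that, for h in
   a subgroup H_i of G, the elements t_i h t_i^-1 are units (and, in the last
   part, by G and one letter subject to no condition). Its maximal group image
   is the free product of G and the free group on the t_i. Reducing a word to
   normal form only cancels idempotents t t^-1 or t^-1 t, so every element of M
   lies below its normal form in the natural order; in particular an element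
   with trivial image lies below 1, and M is E-unitary.
   For a finite set L of pairs (i, x), let e be the product of the idempotents
   x t_i^-1 t_i x^-1. Such a factor depends only on i and the coset x H_i, so
   an element g of G stabilising, for every i, the union Y_i of the cosets
   x H_i commutes with e, and e g is in the group H-class of e. Conversely M
   acts by partial injections on the normal forms in which a letter t_i^-1
   occurs only directly after t_i h with h in H_i, or at the start after an
   element of Y_i. An element m of the H-class of e permutes the domain of e;
   if two letters occur in L, every point of this domain is in G, so the image
   of 1 under m is some g in G, and g stabilises the Y_i because m preserves the
   domain. Hence m = e g.
   Take letters with H_i = H, G, G and L such that Y_i = X H, G, G. All the
   conditions on the letters say that some words v are right units, and they
   all follow from the single relation obtained by putting the product of the
   words v v^-1 in front of one relator of G. *)

Require Import Defs.
From mathcomp Require Import all_boot.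
From mathcomp Require Import boolp classical_sets functions cardinality.

Set Implicit Arguments.
Unset Strict Implicit.
Unset Printing Implicit Defensive.

Local Open Scope classical_set_scope.
Local Open Scope card_scope.
Local Open Scope group_scope.
Local Open Scope quotient_scope.

(** * Inverse monoids *)

Section InverseMonoid.
Variables (M : starMonoidType) (invM : inverse_monoid M).
Implicit Types (x y z e f : M).

Lemma mulVK x : x * x^-1 * x = x.
Proof. by have [] := (invM x x^-1).2 erefl. Qed.

Lemma VmulK x : x^-1 * x * x^-1 = x^-1.
Proof. by have := mulVK x^-1; rewrite invgK. Qed.

Lemma idem_inv e : e * e = e -> e^-1 = e.
Proof. by move=> ee; apply/esym/(invM e e); rewrite !ee. Qed.

Lemma idem_mulV x : x * x^-1 * (x * x^-1) = x * x^-1.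
Proof. by rewrite mulgA mulVK. Qed.

Lemma idem_Vmul x : x^-1 * x * (x^-1 * x) = x^-1 * x.
Proof. by have := idem_mulV x^-1; rewrite invgK. Qed.

(** Here [(e * f)^-1 = f * e], and regularity of [e * f] collapses to [e * f * (e * f) = e * f]; so
    [e * f] is idempotent, hence its own inverse. *)
Lemma idem_comm e f : e * e = e -> f * f = f -> e * f = f * e.
Proof.
move=> ee ff; have ef : (e * f)^-1 = f * e by rewrite invgM !idem_inv.
suff : e * f * (e * f) = e * f by move=> /idem_inv; rewrite ef => ->.
by have := mulVK (e * f); rewrite ef !mulgA -(mulgA e f f) ff -(mulgA _ e e) ee.
Qed.

Lemma idemM e f : e * e = e -> f * f = f -> e * f * (e * f) = e * f.
Proof.
by move=> ee ff; rewrite -mulgA (mulgA f) -(idem_comm ee ff) -mulgA ff mulgA ee.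
Qed.

Lemma idem_conj x e : e * e = e -> x * e * x^-1 * (x * e * x^-1) = x * e * x^-1.
Proof.
move=> ee; rewrite -!mulgA (mulgA x^-1) (mulgA e (x^-1 * x)).
rewrite (idem_comm ee (idem_Vmul x)) !mulgA mulVK.
by rewrite -(mulgA x e e) ee.
Qed.

Lemma mul_idem_conj x e : e * e = e -> x * e = x * e * x^-1 * x.
Proof.
by move=> ee; rewrite -!mulgA (idem_comm ee (idem_Vmul x)) !mulgA mulVK.
Qed.

Definition natural_le x y := exists2 e, e * e = e & x = e * y.

Lemma natural_le_refl x : natural_le x x.
Proof. by exists 1; rewrite mul1g. Qed.

Lemma natural_le_eq x y : x = y -> natural_le x y.
Proof. by move=> ->; apply: natural_le_refl. Qed.

Lemma natural_le_trans y x z : natural_le x y -> natural_le y z -> natural_le x z.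
Proof.
move=> [e ee ->] [f ff ->]; exists (e * f); last by rewrite mulgA.
exact: idemM.
Qed.

Lemma natural_leMr z x y : natural_le x y -> natural_le (x * z) (y * z).
Proof. by move=> [e ee ->]; exists e => //; rewrite mulgA. Qed.

(** Conjugation by [x] moves the inner idempotent to the far left, where the order is defined. *)
Lemma natural_le_idem x e y : e * e = e -> natural_le (x * e * y) (x * y).
Proof.
move=> ee; exists (x * e * x^-1); first exact: idem_conj.
by rewrite [RHS]mulgA -(mul_idem_conj x ee).
Qed.

Lemma natural_le1 x : natural_le x 1 -> x * x = x.
Proof. by move=> [e ee ->]; rewrite mulg1. Qed.

Lemma idem_right_unit e x : e * e = e -> e * x = 1 -> e = 1.
Proof. by move=> ee ex; rewrite -[e]mulg1 -ex mulgA ee. Qed.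

(** Right units are maximal: if [e * y] is one, then [e] has a right inverse, and an idempotent with
    a right inverse is 1. *)
Lemma natural_le_right_unit x y : natural_le x y -> x * x^-1 = 1 -> x = y.
Proof.
move=> [e ee ->] ey; suff -> : e = 1 by rewrite mul1g.
by apply: (@idem_right_unit e (y * (e * y)^-1)) => //; rewrite mulgA.
Qed.

Lemma right_unitM x y :
  x * x^-1 = 1 -> y * y^-1 = 1 -> x * y * (x * y)^-1 = 1.
Proof.
by move=> xx yy; rewrite invgM -mulgA (mulgA y) yy mul1g.
Qed.

Lemma inverse_morphV (N : starMonoidType) (f : M -> N) :
  inverse_monoid N -> monoid_morphism f -> {morph f : x / x^-1}.
Proof.
by move=> invN [_ fM] x; apply/(invN (f x)); rewrite -!fM mulVK VmulK.
Qed.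

End InverseMonoid.

(** * Values of words under an assignment of the letters *)

Section Evaluation.
Variables (A : Type) (N : starMonoidType) (h : A -> N).
Implicit Types u v w : word A.

Definition eval_letter (x : A * bool) : N := if x.2 then (h x.1)^-1 else h x.1.

Definition eval w : N := \prod_(x <- w) eval_letter x.

Lemma eval_nil : eval [::] = 1. Proof. exact: big_nil. Qed.

Lemma eval_cons x w : eval (x :: w) = eval_letter x * eval w.
Proof. exact: big_cons. Qed.

Lemma eval_cat u v : eval (u ++ v) = eval u * eval v.
Proof. exact: big_cat. Qed.

Lemma eval1 x : eval [:: x] = eval_letter x.
Proof. exact: big_seq1. Qed.

Lemma winv_cons (x : A * bool) w : winv (x :: w) = winv w ++ [:: (x.1, ~~ x.2)].
Proof. by rewrite /winv /= rev_cons cats1. Qed.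

Lemma eval_winv w : eval (winv w) = (eval w)^-1.
Proof.
elim: w => [|[a b] w IH]; first by rewrite eval_nil invg1.
rewrite winv_cons eval_cat eval1 eval_cons invgM IH /eval_letter /=.
by case: b => //=; rewrite invgK.
Qed.

End Evaluation.

Lemma eval_morph (A : Type) (N N' : starMonoidType) (h : A -> N) (f : N -> N') :
  monoid_morphism f -> {morph f : x / x^-1} ->
  forall w, f (eval h w) = eval (f \o h) w.
Proof.
move=> [f1 fM] fV; elim=> [|[a b] w IH]; first by rewrite !eval_nil.
by rewrite !eval_cons fM IH /eval_letter; case: b => /=; rewrite ?fV.
Qed.

(** * Universal properties of presentations and the maximal group image *)

Section PresentationFacts.
Variables (A : choiceType) (R : set (word A * word A)).
Implicit Types u v w : word A.

Definition igen (a : A) : invPres R := \pi_(invPres R) [:: (a, false)].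
Definition ggen (a : A) : gpPres R := \pi_(gpPres R) [:: (a, false)].

Lemma ipV w : \pi_(invPres R) (winv w) = (\pi_(invPres R) w)^-1.
Proof. by rewrite -invPres_inv_pi. Qed.

Lemma gpV w : \pi_(gpPres R) (winv w) = (\pi_(gpPres R) w)^-1.
Proof.
apply: (mulgI (\pi_(gpPres R) w)).
by rewrite mulgV gp_mulwV.
Qed.

Lemma ip_eval w : \pi_(invPres R) w = eval igen w.
Proof.
elim: w => [|[a b] w IH]; first by rewrite eval_nil.
rewrite eval_cons -IH -cat1s ip_cat; congr (_ * _).
by case: b => //=; rewrite /eval_letter /igen /= -ipV.
Qed.

Lemma gp_eval w : \pi_(gpPres R) w = eval ggen w.
Proof.
elim: w => [|[a b] w IH]; first by rewrite eval_nil.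
rewrite eval_cons -IH -cat1s gp_cat; congr (_ * _).
by case: b => //=; rewrite /eval_letter /ggen /= -gpV.
Qed.

Lemma eval_congr_inv (N : starMonoidType) (h : A -> N) :
  inverse_monoid N -> (forall u v, R (u, v) -> eval h u = eval h v) ->
  forall u v, congr_gen (inv_rel R) u v -> eval h u = eval h v.
Proof.
move=> invN hR u v; elim=> {u v} [u v|//|u v _ //|u v w _ -> _ ->//|].
  case=> [w|{}u w|{}u {}v /hR//].
    by rewrite !eval_cat eval_winv mulgA (mulVK invN).
  by rewrite !catA -catA -(catA (w ++ _)) !eval_cat !eval_winv
    (idem_comm invN (idem_mulV invN _) (idem_mulV invN _)).
by move=> u u' v v' _ + _; rewrite !eval_cat => -> ->.
Qed.

Lemma eval_congr_gp (N : groupType) (h : A -> N) :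
  (forall u v, R (u, v) -> eval h u = eval h v) ->
  forall u v, congr_gen (gp_rel R) u v -> eval h u = eval h v.
Proof.
move=> hR u v; elim=> {u v} [u v|//|u v _ //|u v w _ -> _ ->//|].
  case=> [w|{}u {}v /hR//].
  by rewrite eval_cat eval_winv mulgV eval_nil.
by move=> u u' v v' _ + _; rewrite !eval_cat => -> ->.
Qed.

Lemma eval_extends (N : starMonoidType) (h : A -> N) :
  inverse_monoid N -> (forall u v, R (u, v) -> eval h u = eval h v) ->
  exists f : invPres R -> N,
    monoid_morphism f /\ forall w, f (\pi_(invPres R) w) = eval h w.
Proof.
move=> invN hR; exists (fun x => eval h (repr x)).
have fE w : eval h (repr (\pi_(invPres R) w)) = eval h w.
  by apply: eval_congr_inv => //; apply: repr_congr.
split=> //; split=> [|x y]; first by rewrite -pi_nil fE eval_nil.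
case: (ip_surj x) (ip_surj y) => u -> [v ->].
by rewrite -ip_cat !fE eval_cat.
Qed.

Lemma sigma_morphism : monoid_morphism (@sigma A R).
Proof.
split=> [|x y]; first by rewrite -pi_nil sigma_pi.
case: (ip_surj x) (ip_surj y) => u -> [v ->].
by rewrite -ip_cat !sigma_pi gp_cat.
Qed.

Lemma sigma_idem (e : invPres R) : e * e = e -> sigma e = 1.
Proof.
move=> ee; apply: (mulgI (sigma e)).
by rewrite -(sigma_morphism.2) ee mulg1.
Qed.

Lemma sigma_natural_le (x y : invPres R) : natural_le x y -> sigma x = sigma y.
Proof. by move=> [e ee ->]; rewrite (sigma_morphism.2) (sigma_idem ee) mul1g. Qed.

End PresentationFacts.

Section SubgroupFacts.
Variables (G : groupType) (K : set G).
Hypothesis subK : subgroup K.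

Lemma subgroup_one : K 1.
Proof. by have [] := subK; rewrite inE. Qed.

Lemma subgroup_mul g h : K g -> K h -> K (g * h).
Proof.
have /group_closedM KM := subK.
by move=> /mem_set + /mem_set => /KM/[apply]/set_mem.
Qed.

Lemma subgroup_inv g : K g -> K g^-1.
Proof. by have /group_closedV KV := subK; move=> /mem_set/KV/set_mem. Qed.

End SubgroupFacts.

Lemma subgroup1 (G : groupType) : subgroup [set 1 : G].
Proof. by split=> [|x y]; rewrite ?inE // => -> ->; rewrite mulgV. Qed.

Lemma subgroupT (G : groupType) : subgroup [set: G].
Proof. by split=> [|x y _ _]; apply: mem_set. Qed.

(** * Normal forms in the free product of G and a free group *)

Section ReducedStates.
Variables (G : groupType) (B I : choiceType) (phi : B -> G).
Implicit Types (g : G) (i : I) (t : I * bool) (x : (B + I)%type * bool).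

Definition lift (w : word B) : word (B + I)%type :=
  [seq (inl p.1, p.2) | p <- w].

Lemma lift_cat u v : lift (u ++ v) = lift u ++ lift v.
Proof. exact: map_cat. Qed.

Lemma lift_winv w : lift (winv w) = winv (lift w).
Proof. by rewrite /lift /winv map_rev -!map_comp. Qed.

Definition conj_word i (u : word B) : word (B + I)%type :=
  (inr i, false) :: lift u ++ [:: (inr i, true)].

(* The state ([:: (g1, t1); (g2, t2); ...], g) stands for the product
   ... g2 t2 g1 t1 g in the free product of G with the free group on I. *)
Definition stack := seq (G * (I * bool)).
Definition state := (stack * G)%type.
Implicit Types (l : stack) (z : state).

Definition flip t : I * bool := (t.1, ~~ t.2).

Definition cancels l g t : bool :=
  if l is (_, t') :: _ then (g == 1) && (t' == flip t) else false.

(** Right multiplication of a normal form by a stable letter: pop or push. The default of [head] is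
    never reached, since [cancels] fails on the empty stack. *)
Definition act_stable z t : state :=
  if cancels z.1 z.2 t then (behead z.1, (head (1, t) z.1).1)
  else ((z.2, t) :: z.1, 1).

Definition act1 z x : state :=
  match x with
  | (inl b, e) => (z.1, z.2 * eval_letter phi (b, e))
  | (inr i, e) => act_stable z (i, e)
  end.

Definition act : state -> word (B + I)%type -> state := foldl act1.

Fixpoint reduced l : bool :=
  if l is (g, t) :: l' then ~~ cancels l' g t && reduced l' else true.

Lemma flipK : involutive flip.
Proof. by case=> i e; rewrite /flip /= negbK. Qed.

Lemma act_cons z x w : act z (x :: w) = act (act1 z x) w.
Proof. by []. Qed.

Lemma act_cat z u v : act z (u ++ v) = act (act z u) v.
Proof. exact: foldl_cat. Qed.

Lemma act_lift l g w : act (l, g) (lift w) = (l, g * eval phi w).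
Proof.
elim: w g => [|[b e] w IH] g /=; first by rewrite eval_nil mulg1.
by rewrite IH eval_cons mulgA.
Qed.

Variant act_stable_spec l g t : state -> Prop :=
| ActPop g' l' of l = (g', flip t) :: l' & g = 1 :
    act_stable_spec l g t (l', g')
| ActPush of ~~ cancels l g t : act_stable_spec l g t ((g, t) :: l, 1).

Lemma act_stableP l g t : act_stable_spec l g t (act_stable (l, g) t).
Proof.
rewrite /act_stable; case: ifPn => /=; last by constructor.
by case: l => [//|[g' t'] l] /= /andP[/eqP -> /eqP ->]; constructor.
Qed.

Lemma act_stableK l g t :
  reduced l -> act_stable (act_stable (l, g) t) (flip t) = (l, g).
Proof.
case: act_stableP => [g' l' -> -> /= /andP[nc _]|nc _].
  by rewrite /act_stable (negbTE nc).
by rewrite /act_stable /= flipK !eqxx.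
Qed.

Lemma act1_reduced z x : reduced z.1 -> reduced (act1 z x).1.
Proof.
case: z x => l g [[b|i] e] //= lr.
case: act_stableP => [g' l' El _|nc] /=; last by rewrite nc.
by move: lr; rewrite El => /andP[].
Qed.

Lemma act_reduced z w : reduced z.1 -> reduced (act z w).1.
Proof. by elim: w z => //= x w IH z zr; apply/IH/act1_reduced. Qed.

Lemma act1K z x : reduced z.1 -> act1 (act1 z x) (x.1, ~~ x.2) = z.
Proof.
case: z x => l g [[b|i] e] /= lr; last exact: act_stableK.
by rewrite /eval_letter /=; case: e => /=; rewrite ?mulgVK ?mulgK.
Qed.

Lemma act_winv z w : reduced z.1 -> act z (w ++ winv w) = z.
Proof.
elim: w z => // x w IH z zr; rewrite winv_cons catA act_cat.
by rewrite cat_cons (act_cons z) IH ?act1_reduced //; apply: act1K.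
Qed.

(** * The partial action on valid normal forms *)

Section Valid.
Variables (c : pred I) (H Y : I -> set G).

(* Letters with c i are the right units t_i of the construction; the inverse
   letter of t_i may be read at t_i h with h in H i, and at y with y in Y i. *)
Definition valid_entry l g t : Prop :=
  if t.2 then
    if l is (_, t') :: _ then t' = (t.1, false) /\ H t.1 g else Y t.1 g
  else c t.1.

Fixpoint valid l : Prop :=
  if l is (g, t) :: l' then
    [/\ ~~ cancels l' g t, valid_entry l' g t & valid l']
  else True.

(** The domain of the partial injection given by [w]: all states on the path, both ends included,
    must be valid. *)
Fixpoint readable z (w : word (B + I)%type) : Prop :=
  if w is x :: w' then valid z.1 /\ readable (act1 z x) w' else valid z.1.

Lemma valid_reduced l : valid l -> reduced l.
Proof. by elim: l => //= -[g t] l IH [-> _ /IH]. Qed.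

Lemma readable_valid z w : readable z w -> valid z.1.
Proof. by case: w => //= x w []. Qed.

Lemma readable_cat z u v : readable z (u ++ v) <-> readable z u /\ readable (act z u) v.
Proof.
elim: u z => [|x u IH] z /=; last by rewrite (IH (act1 z x)); tauto.
by split=> [zv|[]//]; split=> //; apply: readable_valid zv.
Qed.

Lemma readable1 z x : readable z [:: x] <-> valid z.1 /\ valid (act1 z x).1.
Proof. by []. Qed.

(** The inverse word retraces the path through the same states. *)
Lemma readable_winv z w : readable z w -> readable (act z w) (winv w).
Proof.
elim: w z => [//|x w IH] z [zv xw]; have zr := valid_reduced zv.
rewrite winv_cons; apply/readable_cat; split; first exact: IH.
rewrite (act_cons z) -act_cat act_winv ?act1_reduced //.
by apply/readable1; rewrite act1K //; split=> //; apply: readable_valid xw.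
Qed.

Lemma readable_mulV z w : readable z (w ++ winv w) <-> readable z w.
Proof.
rewrite readable_cat; split=> [[]//|zw]; split=> //; exact: readable_winv.
Qed.

Lemma readable_Vmul z w : readable z (winv w ++ w) <-> readable z (winv w).
Proof. by rewrite -[X in _ ++ X]winvK; apply: readable_mulV. Qed.

Lemma readable_lift z w : readable z (lift w) <-> valid z.1.
Proof.
by elim: w z => [|x w IH] //= z; rewrite IH; case: z => l g /=; tauto.
Qed.

(** What the relation [r = 1] needs: the first half concerns the total action, hence the maximal
    group image, the second the partial action, hence the inverse monoid. *)
Definition sound (r : word (B + I)%type) : Prop :=
  (forall z, reduced z.1 -> act z r = z) /\ (forall z, valid z.1 -> readable z r).

Lemma sound_cat u v : sound u -> sound v -> sound (u ++ v).
Proof.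
move=> [ua ur] [va vr]; split=> z zv; first by rewrite act_cat ua // va.
apply/readable_cat; split; first exact: ur.
by rewrite ua; [exact: vr|exact: valid_reduced].
Qed.

Lemma sound_flatten (s : seq (word (B + I)%type)) :
  (forall v, v \in s -> sound v) -> sound (flatten s).
Proof.
elim: s => [|v s IH] vs //=; apply: sound_cat; first by apply: vs; rewrite inE eqxx.
by apply: IH => w ws; apply: vs; rewrite inE ws orbT.
Qed.

Lemma sound_mulV v : (forall z, valid z.1 -> readable z v) -> sound (v ++ winv v).
Proof.
move=> vr; split=> z zv; first exact: act_winv.
by apply/readable_mulV/vr.
Qed.

Lemma sound_lift w : eval phi w = 1 -> sound (lift w).
Proof.
move=> w1; split=> -[l g] zv; first by rewrite act_lift w1 mulg1.
exact/readable_lift.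
Qed.

Lemma valid_act_positive z i : c i -> valid z.1 -> valid (act_stable z (i, false)).1.
Proof.
case: z => l g ci /= lv; case: act_stableP => [g' l' El _|nc] //=.
by move: lv; rewrite El => -[].
Qed.

Lemma readable_conj z i w :
  c i -> (forall g h, Y i g -> H i h -> Y i (g * h)) ->
  (forall g h, H i g -> H i h -> H i (g * h)) -> H i (eval phi w) ->
  valid z.1 -> readable z (conj_word i w).
Proof.
case: z => l g ci YH HH Hw lv; split=> //; apply/readable_cat.
have tv : valid (act_stable (l, g) (i, false)).1 by exact: valid_act_positive.
split; first exact/readable_lift.
have -> : act1 (l, g) (inr i, false) = act_stable (l, g) (i, false) by [].
(* If [t_i] cancels a [t_i^-1], the entry of that letter is multiplied on the right by an element of
   [H i] before [t_i^-1] is read again, and [YH] or [HH] keeps it valid. If [t_i] is pushed,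
   [t_i^-1] is read directly above it at [eval phi w], where it cancels or is valid by [Hw]. *)
case: act_stableP tv => [g' l' El Eg|nc] tv; rewrite act_lift; apply/readable1.
  split=> //=.
  case: act_stableP => [h l'' El' hl|nc] /=; first by move: tv; rewrite El' => -[].
  split=> //; move: lv; rewrite El /= => -[_ + _].
  rewrite /valid_entry /=; case: (l') => [|[_ t'] _]; first by move/YH; apply.
  by move=> [-> /HH]; split=> //; auto.
rewrite mul1g; split=> //=.
by case: act_stableP => [h l'' [_ <-] _|nc'].
Qed.

End Valid.

End ReducedStates.

(** * Groups extended by right units *)

Lemma ip_conj_word (B I : choiceType) (R : set (word (B + I)%type * word (B + I)%type))
    (i : I) (u : word B) :
  \pi_(invPres R) (conj_word i u) =
    igen R (inr i) * \pi_(invPres R) (lift I u) * (igen R (inr i))^-1.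
Proof. by rewrite /conj_word -cat1s !ip_cat mulgA -ipV. Qed.

Definition gword (G : groupType) (B : choiceType) (phi : B -> G) (g : G) : word B :=
  xget [::] [set u | eval phi u = g].

Lemma eval_gword (G : groupType) (B : choiceType) (phi : B -> G) :
  (forall g, exists u, eval phi u = g) -> forall g, eval phi (gword phi g) = g.
Proof. by move=> gen g; have := xgetPex [::] (gen g). Qed.

Definition right_invariant (G : groupType) (I : Type) (H Y : I -> set G) : Prop :=
  forall i g h, Y i g -> H i h -> Y i (g * h).

(* R presents the inverse monoid generated by a group of units G and the
   letters in I, where for each i with c i the elements t_i h t_i^-1 with
   h in H i are units, and nothing is imposed on the other letters. *)
Record adapted (G : groupType) (B I : choiceType) (phi : B -> G) (c : pred I)
    (H : I -> set G) (R : set (word (B + I)%type * word (B + I)%type)) : Prop := {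
  adapted_special : special R;
  adapted_sound : forall Y r,
    right_invariant H Y -> R (r, [::]) -> sound phi c H Y r;
  adapted_group : forall u v, eval phi u = eval phi v ->
    \pi_(invPres R) (lift I u) = \pi_(invPres R) (lift I v);
  adapted_unit : forall i u, c i -> H i (eval phi u) ->
    \pi_(invPres R) (conj_word i u) * (\pi_(invPres R) (conj_word i u))^-1 = 1;
  adapted_gen : forall g, exists u, eval phi u = g;
  adapted_subgroup : forall i, subgroup (H i);
  adapted_trivial : forall i, ~~ c i -> H i = [set 1]
}.

Section Construction.
Variables (G : groupType) (B I : choiceType) (phi : B -> G).
Variables (c : pred I) (H : I -> set G).
Variable R : set (word (B + I)%type * word (B + I)%type).
Hypothesis adaptedR : adapted phi c H R.
Implicit Types (g : G) (i : I) (l : stack G I) (z : state G I).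
Implicit Types (w : word (B + I)%type) (u v : word B).

Notation M := (invPres R).
Notation ip := (\pi_(invPres R)).
Notation act := (act phi).

Let invM : inverse_monoid M := @invPres_inverse_monoid _ R.

Let H1 i : H i 1.
Proof. exact: (subgroup_one (adapted_subgroup adaptedR i)). Qed.

Let HM i g h : H i g -> H i h -> H i (g * h).
Proof. exact: (subgroup_mul (adapted_subgroup adaptedR i)). Qed.

Let HV i g : H i g -> H i g^-1.
Proof. exact: (subgroup_inv (adapted_subgroup adaptedR i)). Qed.

(** Relators fix every reduced state, so the total action factors through the maximal group
    image. *)
Lemma act_congr w1 w2 z :
  congr_gen (gp_rel R) w1 w2 -> reduced z.1 -> act z w1 = act z w2.
Proof.
move=> w12; elim: w12 z => {w1 w2}
  [w1 w2|//|w1 w2 _ IH z /IH //|w1 w2 w3 _ IH1 _ IH2 z zr|].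
- case=> [w|{}w1 {}w2 Rw] z zr; first exact: act_winv.
  have E := adapted_special adaptedR Rw; rewrite E in Rw *.
  have H0 : right_invariant H (fun=> set0) by [].
  by have [-> ] := adapted_sound adaptedR H0 Rw.
- by rewrite IH1 // IH2.
- move=> w1 w1' w2 w2' _ IH1 _ IH2 z zr.
  by rewrite !act_cat IH1 // IH2 // act_reduced.
Qed.

Lemma act_sigma w1 w2 z :
  sigma (ip w1) = sigma (ip w2) -> reduced z.1 -> act z w1 = act z w2.
Proof. by rewrite !sigma_pi => /wquotP; apply: act_congr. Qed.

(** Reading [w ++ winv w] returns to the start, so such words only restrict the domain and commute;
    relators can be read at every valid state. *)
Lemma readable_congr Y w1 w2 z : right_invariant H Y -> congr_gen (inv_rel R) w1 w2 ->
  readable phi c H Y z w1 <-> readable phi c H Y z w2.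
Proof.
move=> YH w12; elim: w12 z => {w1 w2}
  [w1 w2|//|w1 w2 _ IH z|w1 w2 w3 _ IH1 _ IH2 z|].
- case=> [w|u w|{}w1 {}w2 Rw] z.
  + rewrite !readable_cat; split=> [[]//|zw].
    have zr := valid_reduced (readable_valid zw).
    have zwV := readable_winv zw.
    by rewrite -act_cat act_winv.
  + rewrite !(catA u) !(catA w).
    rewrite (readable_cat _ _ _ _ _ (u ++ _)) (readable_cat _ _ _ _ _ (w ++ _)).
    rewrite !readable_mulV.
    split=> -[z1]; have zr := valid_reduced (readable_valid z1);
      by rewrite act_winv // => ?; split=> //; rewrite act_winv.
  + have E := adapted_special adaptedR Rw; rewrite E in Rw *.
    have [_ rd] := adapted_sound adaptedR YH Rw.
    by split=> [/readable_valid//|]; apply: rd.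
- by rewrite IH.
- by rewrite IH1 IH2.
- move=> w1 w1' w2 w2' C1 IH1 C2 IH2 z; rewrite !readable_cat IH1.
  have E : readable phi c H Y z w1' -> act z w1 = act z w1'.
    move=> zw; have zr := valid_reduced (readable_valid zw); apply: act_sigma => //.
    by congr sigma; apply/wquotP.
  by split=> -[zw1 /IH2]; rewrite E.
Qed.

Local Notation gword := (gword phi).

Let eval_gword g : eval phi (gword g) = g.
Proof. exact: eval_gword (adapted_gen adaptedR) g. Qed.

Definition giota g : M := ip (lift I (gword g)).

Lemma ip_lift u : ip (lift I u) = giota (eval phi u).
Proof. by apply: (adapted_group adaptedR); rewrite eval_gword. Qed.

Lemma giotaM : {morph giota : g h / g * h}.
Proof.
move=> g h; rewrite -[g in LHS]eval_gword -[h in LHS]eval_gword -eval_cat.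
by rewrite -ip_lift lift_cat ip_cat.
Qed.

Lemma giota1 : giota 1 = 1.
Proof. by rewrite -[X in giota X](eval_nil phi) -ip_lift. Qed.

Lemma giotaV g : (giota g)^-1 = giota g^-1.
Proof.
by rewrite -[g in RHS]eval_gword -eval_winv -ip_lift lift_winv ipV.
Qed.

Lemma giotaK g : giota g * giota g^-1 = 1.
Proof. by rewrite -giotaM mulgV giota1. Qed.

Lemma giotaVK g : giota g^-1 * giota g = 1.
Proof. by rewrite -giotaM mulVg giota1. Qed.

Definition tau i : M := igen R (inr i).

Lemma igen_inl b : igen R (inl b) = giota (phi b).
Proof. by rewrite -[phi b](eval1 phi (b, false)) -ip_lift. Qed.

Fixpoint stack_val l : M :=
  if l is (g, t) :: l' then
    stack_val l' * giota g * (if t.2 then (tau t.1)^-1 else tau t.1)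
  else 1.

Definition state_val z : M := stack_val z.1 * giota z.2.

(** Equality holds unless a letter is popped; then an idempotent [t * t^-1] or [t^-1 * t] is
    dropped. *)
Lemma state_val_act1 z x :
  natural_le (state_val z * eval_letter (igen R) x) (state_val (act1 phi z x)).
Proof.
case: z x => l g [[b|i] e] /=.
  rewrite /state_val /= giotaM mulgA; apply/natural_le_eq.
  by congr (_ * _ * _); rewrite /eval_letter /= igen_inl; case: e => //; rewrite giotaV.
rewrite /state_val; case: act_stableP => [g' l' -> ->|_] /=; last first.
  by apply/natural_le_eq; rewrite giota1 mulg1.
rewrite giota1 mulg1 -mulgA -[X in natural_le _ X]mulg1 -[X in natural_le X _]mulg1.
rewrite /eval_letter /=; case: e => /=; apply: natural_le_idem => //.
  exact: idem_mulV.
exact: idem_Vmul.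
Qed.

Lemma state_val_act z w :
  natural_le (state_val z * ip w) (state_val (act z w)).
Proof.
elim: w z => [|x w IH] z; first by rewrite pi_nil mulg1; apply: natural_le_refl.
rewrite -cat1s ip_cat mulgA act_cat; apply: natural_le_trans (IH _) => //.
by apply: natural_leMr; rewrite ip_eval eval1; apply: state_val_act1.
Qed.

Lemma natural_le_act w g : act ([::], 1) w = ([::], g) -> natural_le (ip w) (giota g).
Proof.
by move=> E; have := state_val_act ([::], 1) w; rewrite E /state_val /= giota1 !mul1g.
Qed.

Lemma construction_E_unitary : E_unitary R.
Proof.
apply/seteqP; split=> x /=; last exact: sigma_idem.
have [w ->] := ip_surj x => sw1; apply: natural_le1.
rewrite -giota1; apply: natural_le_act.
by rewrite (@act_sigma w [::]) // sw1 pi_nil (sigma_morphism R).1.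
Qed.

(** The action on the base state [([::], 1)] recovers [g]. *)
Lemma sigma_giota_inj : injective (fun g => sigma (giota g)).
Proof.
move=> g h /= gh.
have E : act ([::], 1) (lift I (gword g)) = act ([::], 1) (lift I (gword h)).
  by apply: act_sigma.
by move: E; rewrite !act_lift !mul1g !eval_gword => -[].
Qed.

Definition tidem i g : M := giota g * ((tau i)^-1 * tau i) * (giota g)^-1.

Lemma tidem_idem i g : tidem i g * tidem i g = tidem i g.
Proof. by apply: idem_conj => //; apply: idem_Vmul. Qed.

Lemma tidem_conj i g h : giota g * tidem i h * (giota g)^-1 = tidem i (g * h).
Proof. by rewrite /tidem giotaM invgM !mulgA. Qed.

Lemma tidem_le i h : H i h -> tidem i 1 * tidem i h = tidem i 1.
Proof.
case ci: (c i); last first.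
  by rewrite (adapted_trivial adaptedR) ?ci // => ->; apply: tidem_idem.
move=> Hh; have Hw : H i (eval phi (gword h)) by rewrite eval_gword.
have := adapted_unit adaptedR ci Hw.
rewrite ip_conj_word -/(giota h) -/(tau i).
rewrite !invgM invgK => E.
(* The right-unit equation [E] is placed between [(tau i)^-1] and [tau i]. *)
have fkf : tidem i 1 * tidem i h * tidem i 1 = tidem i 1.
  rewrite /tidem giota1 invg1 mul1g mulg1 -[in RHS](mulg1 (tau i)^-1).
  by rewrite -E !mulgA.
rewrite -[in RHS]fkf -[RHS]mulgA (idem_comm invM (tidem_idem i h)) ?tidem_idem //.
by rewrite [RHS]mulgA tidem_idem.
Qed.

Lemma tidem_coset i g h : H i h -> tidem i (g * h) = tidem i g.
Proof.
move=> Hh; rewrite -[in RHS](mulg1 g) -!tidem_conj; congr (_ * _ * _).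
have kE : tidem i h = giota h * tidem i 1 * giota h^-1.
  by rewrite -giotaV tidem_conj mulg1.
have fE : tidem i 1 = giota h * tidem i h^-1 * giota h^-1.
  by rewrite -giotaV tidem_conj mulgV.
(* The reverse inequality: [tidem_le] for [h^-1], conjugated by [h]. *)
have kf : tidem i h * tidem i 1 = tidem i h.
  have conjM (a b x y : M) :
    b * a = 1 -> x * y = x -> a * x * b * (a * y * b) = a * x * b.
    by move=> ba xy; rewrite !mulgA -(mulgA _ b a) ba mulg1 -(mulgA a x y) xy.
  by have := conjM _ _ _ _ (giotaVK h) (tidem_le (HV Hh)); rewrite -kE -fE.
by rewrite -kf (idem_comm invM (tidem_idem _ _) (tidem_idem _ _)) tidem_le.
Qed.

(** * Stabilisers of unions of cosets as group H-classes *)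

Section Stabiliser.
Variable L : seq (I * G).

Definition coset_union i : set G :=
  [set g | exists2 p, p \in L & p.1 = i /\ exists2 h, H i h & g = p.2 * h].

Definition exit_word (p : I * G) : word (B + I)%type :=
  lift I (gword p.2) ++ [:: (inr p.1, true)].

Definition exits_word : word (B + I)%type :=
  flatten [seq exit_word p ++ winv (exit_word p) | p <- L].

(** The idempotent whose H-class is determined. Its domain consists of the valid states at which,
    for each [(i, x)] in [L], the letter [t_i^-1] can be read after [x]. *)
Definition exits : M := \prod_(p <- L) tidem p.1 p.2.

Local Notation rd := (readable phi c H coset_union).

(** All points of the domain of [exits] lie in [G]; proved later from two distinct letters in [L],
    or from the absence of letters that are right units. *)
Hypothesis exits_bottom : forall l g, rd (l, g) exits_word -> l = [::].

Lemma ip_exit_word p : ip (exit_word p) * (ip (exit_word p))^-1 = tidem p.1 p.2.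
Proof.
rewrite /exit_word ip_cat -/(giota _) (ip_eval _ [:: _]) eval1 /eval_letter /=.
by rewrite /tidem invgM invgK !mulgA.
Qed.

Lemma ip_exits_word : ip exits_word = exits.
Proof.
rewrite /exits_word /exits; elim: L => [|p s IH] /=; first by rewrite big_nil.
by rewrite big_cons ip_cat ip_cat ipV ip_exit_word IH.
Qed.

Lemma readable_exits_word z :
  rd z exits_word <->
  valid c H coset_union z.1 /\ forall p, p \in L -> rd z (exit_word p).
Proof.
rewrite /exits_word; elim: L => [|p s IH] /=; first by split=> [|[]//].
rewrite readable_cat readable_mulV; split=> [[zp]|[zv zs]].
  have zv := readable_valid zp; rewrite act_winv; last exact: valid_reduced zv.
  by move=> /IH[_ zs]; split=> // q; rewrite inE => /predU1P[->|/zs].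
split; first by apply: zs; rewrite inE eqxx.
rewrite act_winv; last exact: valid_reduced zv.
by apply/IH; split=> // q qs; apply: zs; rewrite inE qs orbT.
Qed.

Lemma readable_exit_word l g p :
  rd (l, g) (exit_word p) <->
  valid c H coset_union l /\
  valid c H coset_union (act_stable (l, g * p.2) (p.1, true)).1.
Proof.
rewrite readable_cat readable_lift act_lift eval_gword.
by split=> [[_ /readable1[]]|[lv pv]].
Qed.

Lemma readable_start : rd ([::], 1) exits_word.
Proof.
apply/readable_exits_word; split=> // p pL; apply/readable_exit_word; split=> //=.
split=> //; exists p => //; split=> //; exists 1 => //; by rewrite mulg1 mul1g.
Qed.

(** On the empty stack, [t_i^-1] can be read only at an element of [coset_union i]; applied to
    [g * x] for each [(i, x)] in [L]. *)
Lemma coset_union_readable g : rd ([::], g) exits_word ->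
  forall i x, coset_union i x -> coset_union i (g * x).
Proof.
move=> /readable_exits_word[_ gL] i x [p pL [pi [h Hh ->]]].
have /readable_exit_word[_ [_ + _]] := gL p pL.
rewrite /valid_entry /= => -[q qL [qi [h' Hh' E]]].
exists q => //; split; first by rewrite qi.
exists (h' * h); first by apply: HM => //; rewrite -pi.
by rewrite mulgA E mulgA.
Qed.

Lemma coset_union_invariant : right_invariant H coset_union.
Proof.
move=> i _ h [p pL [pi [h' Hh' ->]]] Hh; exists p => //; split=> //.
by exists (h' * h); [exact: HM|rewrite mulgA].
Qed.

Lemma exits_idem : exits * exits = exits.
Proof.
rewrite /exits; elim: L => [|p s IH]; first by rewrite big_nil mul1g.
by rewrite !big_cons; apply: idemM => //; apply: tidem_idem.
Qed.

(** A factor of the product belongs to the same coset as [g], so it equals [tidem i g] and absorbs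
    it. *)
Lemma tidem_exits i g : coset_union i g -> tidem i g * exits = exits.
Proof.
move=> [p pL [<- [h Hh ->]]]; rewrite tidem_coset // /exits.
elim: (L) pL => //= q s IH; rewrite inE big_cons => /predU1P[->|/IH E].
  by rewrite mulgA tidem_idem.
by rewrite mulgA (idem_comm invM (tidem_idem _ _) (tidem_idem _ _)) -mulgA E.
Qed.

Definition exits_stab : set G :=
  [set g | forall i, [set g * y | y in coset_union i] = coset_union i].

Lemma exits_stabP g :
  (forall i x, coset_union i x -> coset_union i (g * x)) ->
  (forall i x, coset_union i x -> coset_union i (g^-1 * x)) -> exits_stab g.
Proof.
move=> gY gVY i; apply/seteqP; split=> [_ [x xY <-]|x xY]; first exact: gY.
by exists (g^-1 * x); [exact: gVY|rewrite mulgA mulgV mul1g].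
Qed.

Lemma exits_stab_mul g i x : exits_stab g -> coset_union i x -> coset_union i (g * x).
Proof. by move=> gK xY; rewrite -gK; exists x. Qed.

Lemma exits_stabV g i x :
  exits_stab g -> coset_union i x -> coset_union i (g^-1 * x).
Proof.
by move=> gK; rewrite -{1}gK => -[y yY <-]; rewrite mulgA mulVg mul1g.
Qed.

(** Conjugation turns the factor for [(i, x)] into the one for [(i, g * x)], which [exits] absorbs
    as [g * x] is again in [coset_union i]. *)
Lemma conj_exits_absorb g :
  (forall i x, coset_union i x -> coset_union i (g * x)) ->
  giota g * exits * (giota g)^-1 * exits = exits.
Proof.
move=> gY.
have -> : giota g * exits * (giota g)^-1 = \prod_(p <- L) tidem p.1 (g * p.2).
  rewrite {1}/exits; elim: L => [|p s IH].
    by rewrite !big_nil mulg1 giotaV giotaK.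
  rewrite !big_cons -IH -tidem_conj !giotaV !mulgA -(mulgA _ (giota g^-1) (giota g)).
  by rewrite giotaVK mulg1.
(* The induction runs over the first product only, while [exits] stays the product over all of
   [L]. *)
have : {subset L <= L} by [].
elim: {1 3}L => [|p s IH] sL; first by rewrite big_nil mul1g.
rewrite big_cons -mulgA IH; last by move=> q qs; apply: sL; rewrite inE qs orbT.
apply/tidem_exits/gY; exists p; first by apply: sL; rewrite inE eqxx.
by split=> //; exists 1; rewrite ?mulg1.
Qed.

Lemma giota_exits_comm g : exits_stab g -> giota g * exits = exits * giota g.
Proof.
move=> gK; set e := giota g * exits * (giota g)^-1.
have ee : e * e = e by apply: idem_conj => //; exact: exits_idem.
have e1 : e * exits = exits by apply: conj_exits_absorb => i x; exact: exits_stab_mul.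
(* Absorption for [g^-1], conjugated back by [g]. *)
have e2 : exits * e = e.
  have : giota g^-1 * exits * (giota g^-1)^-1 * exits = exits.
    by apply: conj_exits_absorb => i x; exact: exits_stabV.
  move=> /(congr1 (fun x => giota g * x * (giota g)^-1)).
  rewrite !giotaV invgK -/e !mulgA giotaK mul1g -(mulgA exits).
  by rewrite -giotaV /e !mulgA.
have E : e = exits by rewrite -e2 (idem_comm invM exits_idem ee).
by rewrite -{2}E /e -mulgA giotaV giotaVK mulg1.
Qed.

Lemma exits_stab_Hclass : exists (e : M) (f : G -> M),
  [/\ idempotents e, set_bij exits_stab (Hclass e) f &
      {in exits_stab &, {morph f : x y / x * y}}].
Proof.
exists exits, (fun g => exits * giota g); split; first exact: exits_idem.
  split.
  - move=> g gK; rewrite /Hclass /Hrel /=.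
    rewrite invgM (idem_inv invM exits_idem) giotaV !exits_idem; split.
      by rewrite mulgA -(mulgA exits) giotaK mulg1 exits_idem.
    rewrite mulgA -(mulgA _ exits exits) exits_idem -mulgA.
    by rewrite -giota_exits_comm // mulgA giotaVK mul1g.
  (* The idempotent has trivial image under [sigma], and [G] embeds in the maximal group image. *)
  - move=> g h _ _ gh; apply: sigma_giota_inj.
    have := congr1 (@sigma _ R) gh.
    by rewrite !(sigma_morphism R).2 (sigma_idem exits_idem) !mul1g.
  (* Surjectivity: the base state is in the domain of [m * m^-1 = exits], and [m] moves it into the
     domain of [m^-1 * m = exits], hence to an element [g] of [G]. *)
  - move=> m [] mV Vm.
    rewrite (idem_inv invM exits_idem) exits_idem in mV Vm.
    have [w mw] := ip_surj m.
    have mVw : ip (w ++ winv w) = ip exits_word.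
      by rewrite ip_cat ipV ip_exits_word -mw.
    have Vmw : ip (winv w ++ w) = ip exits_word.
      by rewrite ip_cat ipV ip_exits_word -mw.
    have congr_rd w1 w2 z : ip w1 = ip w2 -> rd z w1 <-> rd z w2.
      by move=> /wquotP; apply: readable_congr; exact: coset_union_invariant.
    have start1 : rd ([::], 1) w.
      apply/readable_mulV; apply/(congr_rd _ _ _ mVw).
      exact: readable_start.
    have start2 : rd ([::], 1) (winv w).
      apply/readable_Vmul; apply/(congr_rd _ _ _ Vmw).
      exact: readable_start.
    have end1 : rd (act ([::], 1) w) exits_word.
      apply/(congr_rd _ _ _ Vmw).
      by apply/readable_Vmul; apply: readable_winv.
    have end2 : rd (act ([::], 1) (winv w)) exits_word.
      apply/(congr_rd _ _ _ mVw).
      by apply/readable_mulV; rewrite -[X in rd _ X]winvK; apply: readable_winv.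
    case E : (act ([::], 1) w) end1 => [l g] end1.
    have l0 := exits_bottom end1; rewrite {}l0 in E end1.
    have mg : natural_le m (giota g) by rewrite mw; apply: natural_le_act.
    have gK : exits_stab g.
      apply: exits_stabP; first exact: coset_union_readable.
      apply: coset_union_readable.
      (* As [m] lies below [giota g], both have the same image under [sigma], so [winv w] takes the
         base state to [g^-1], and [end2] applies. *)
      rewrite (_ : ([::], g^-1) = act ([::], 1) (winv w)) //.
      rewrite (@act_sigma _ (winv (lift I (gword g)))) //.
        by rewrite -lift_winv act_lift eval_winv eval_gword mul1g.
      have sV : forall x : M, sigma x^-1 = (sigma x)^-1.
        move=> x; apply: inverse_morphV => //; first exact: group_inverse_monoid.
        exact: sigma_morphism.
      by rewrite !ipV !sV -mw (sigma_natural_le mg).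
    exists g => //.
    (* In [m = f * giota g] the idempotent [f] equals [m * m^-1], that is, [exits]. *)
    have [f ff mf] := mg; rewrite mf -mV mf; congr (_ * _).
    by rewrite invgM (idem_inv invM ff) giotaV mulgA -(mulgA f) giotaK mulg1.
move=> g h /set_mem gK _; rewrite giotaM mulgA.
by rewrite mulgA -(mulgA exits (giota g) exits) giota_exits_comm // mulgA exits_idem.
Qed.

End Stabiliser.

End Construction.

(** * Two situations in which the domain lies in the group *)

Section StabiliserCases.
Variables (G : groupType) (B I : choiceType) (phi : B -> G).
Variables (c : pred I) (H : I -> set G).
Variable R : set (word (B + I)%type * word (B + I)%type).
Hypothesis adaptedR : adapted phi c H R.
Variable L : seq (I * G).
Local Notation rd := (readable phi c H (coset_union H L)).

(** The final letter [t_i^-1] either cancels the top of the stack or is pushed on it; both require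
    [t_i] on top. *)
Lemma exit_word_top l0 (h : G) t g p :
  rd ((h, t) :: l0, g) (exit_word phi p) -> t = (p.1, false).
Proof.
move=> /(readable_exit_word adaptedR)[_].
by case: act_stableP => [g' l' [_ -> _] _ //|_] [_ [] ].
Qed.

Lemma exits_bottom_two_letters p q :
  p \in L -> q \in L -> p.1 <> q.1 ->
  forall l g, rd (l, g) (exits_word phi L) -> l = [::].
Proof.
move=> pL qL pq [//|[h t] l] g /readable_exits_word[_ rL]; case: pq.
by have := exit_word_top (rL p pL); rewrite (exit_word_top (rL q qL)) => -[].
Qed.

Lemma exits_bottom_free : (forall i, ~~ c i) ->
  forall l g, rd (l, g) (exits_word phi L) -> l = [::].
Proof.
move=> nc [//|[h [i e]] l] g /readable_exits_word[/= [_ ve vl] rL].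
(* The stack itself shows that [L] is not empty: positive letters are invalid, so its top is an
   inverse letter with no [t_i] below it, hence at the bottom with an entry in [coset_union]. *)
have [p pL] : exists p, p \in L.
  case: e ve rL; last by rewrite /valid_entry /= (negbTE (nc i)).
  rewrite /valid_entry /=; case: l vl => [_ [p pL _]|[h' t'] l /= [_ vt _] [E _]].
    by exists p.
  by move: vt; rewrite E /valid_entry /= (negbTE (nc i)).
have [_ e0] := exit_word_top (rL p pL); rewrite e0 in ve.
by move: ve; rewrite /valid_entry /= (negbTE (nc i)).
Qed.

End StabiliserCases.

(** The letter [None] detects [XH]. The two letters [Some _] have [G] as their single coset, which
    every element stabilises; being distinct, they confine the domain to [G]. *)
Definition peripheral (G : groupType) (H : set G) (o : option bool) : set G :=
  if o is None then H else setT.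

Lemma stabs_peripheral (G : groupType) (B : choiceType) (phi : B -> G) (H : set G)
    (R : set (word (B + option bool)%type * word (B + option bool)%type)) :
  adapted phi predT (peripheral H) R -> stabs_are_Hclasses H (invPres R).
Proof.
move=> adaptedR X /finite_seqP[s ->] /=.
(* The first two entries are present for every [X], the empty set included. *)
pose L : seq (option bool * G) :=
  [:: (Some true, 1), (Some false, 1) & [seq (None, x) | x <- s]].
have b : forall l g, readable phi predT (peripheral H) (coset_union (peripheral H) L)
    (l, g) (exits_word phi L) -> l = [::].
  apply: (exits_bottom_two_letters adaptedR
    (p := (Some true, 1)) (q := (Some false, 1))); by rewrite ?inE ?eqxx.
have [e [f ef]] := exits_stab_Hclass adaptedR b.
suff -> : setwise_stab [set x * h | x in [set` s] & h in H] =
    exits_stab (peripheral H) L by exists e, f.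
have LN : coset_union (peripheral H) L None = [set x * h | x in [set` s] & h in H].
  apply/seteqP; split=> [x [p pL [p1 [h Hh ->]]]|_ [x xs [h Hh <-]]].
    move: pL; rewrite !inE => /orP[/eqP pE|/orP[/eqP pE|/mapP[y ys ->] /=]].
    - by rewrite pE in p1.
    - by rewrite pE in p1.
    - by exists y => //; exists h.
  exists (None, x); first by rewrite !inE map_f ?orbT.
  by split=> //; exists h.
have LS a : coset_union (peripheral H) L (Some a) = setT.
  apply/seteqP; split=> // g _; exists (Some a, 1); first by case: a; rewrite !inE eqxx.
  by split=> //; exists g; rewrite ?mul1g.
apply/seteqP; split=> g /=; last by move=> /(_ None); rewrite LN.
move=> gX [a|]; last by rewrite LN.
rewrite LS; apply/seteqP; split=> // h _; exists (g^-1 * h) => //.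
by rewrite mulgA mulgV mul1g.
Qed.

Lemma stabs_free (G : groupType) (B : choiceType) (phi : B -> G)
    (R : set (word (B + unit)%type * word (B + unit)%type)) :
  adapted phi pred0 (fun=> [set (1 : G)]) R ->
  stabs_are_Hclasses [set (1 : G)] (invPres R).
Proof.
move=> adaptedR X /finite_seqP[s ->] /=.
pose L := [seq (tt, x) | x <- s].
have [e [f ef]] := exits_stab_Hclass adaptedR
  (exits_bottom_free adaptedR (L := L) (fun=> isT)).
suff -> : setwise_stab [set x * h | x in [set` s] & h in [set (1 : G)]] =
    exits_stab (fun=> [set (1 : G)]) L by exists e, f.
have Ltt : coset_union (fun=> [set (1 : G)]) L tt =
    [set x * h | x in [set` s] & h in [set (1 : G)]].
  apply/seteqP; split=> [x [p pL [p1 [h Hh ->]]]|_ [x xs [h Hh <-]]].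
    by move: pL => /mapP[y ys ->]; exists y => //; exists h.
  exists (tt, x); first by rewrite map_f.
  by split=> //; exists h.
by apply/seteqP; split=> g /=; [move=> gX [] |move=> /(_ tt)]; rewrite Ltt.
Qed.

Lemma invPres_relation (A : choiceType) (R : set (word A * word A)) u v :
  R (u, v) -> \pi_(invPres R) u = \pi_(invPres R) v.
Proof. by move=> Ruv; apply/wquotP; apply: congr_base; exact: inv_rel_relation. Qed.

(** * Presentations on all elements of the group *)

Section CayleyPresentation.
Variables (G : groupType) (I : choiceType) (c : pred I) (H : I -> set G).
Hypothesis subH : forall i, subgroup (H i).
Hypothesis trivH : forall i, ~~ c i -> H i = [set 1].

(** The three families make the letters from [G] units, the words [t_i g t_i^-1] right units, and
    impose the multiplication table of [G]. *)
Definition cayley_relators : set (word (G + I)%type * word (G + I)%type) :=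
  [set r | r.2 = [::] /\
    [\/ exists g e, r.1 = [:: (inl g, e); (inl g, ~~ e)],
        exists2 i, c i & exists2 g, H i g &
          r.1 = conj_word i [:: (g, false)] ++ winv (conj_word i [:: (g, false)])
      | exists g h, r.1 = lift I [:: (g, false); (h, false); (g * h, true)]]].

Notation ip := (\pi_(invPres cayley_relators)).

Let relator r : cayley_relators (r, [::]) -> ip r = 1.
Proof. exact: invPres_relation. Qed.

Let letter g : invPres cayley_relators := igen _ (inl g).

Let letterV g : letter g * (letter g)^-1 = 1 /\ (letter g)^-1 * letter g = 1.
Proof.
have lE e : ip [:: (inl g, e)] * ip [:: (inl g, ~~ e)] = 1.
  by rewrite -ip_cat; apply: relator; split=> //; apply: Or31; exists g, e.
have := lE false; have := lE true.
by rewrite !(ip_eval _ [:: _]) !eval1.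
Qed.

Let letterM g h : letter g * letter h = letter (g * h).
Proof.
have : ip (lift I [:: (g, false); (h, false); (g * h, true)]) = 1.
  by apply: relator; split=> //; apply: Or33; exists g, h.
rewrite ip_eval !eval_cons eval_nil mulg1 /eval_letter /= => E.
by rewrite -[LHS]mulg1 -(letterV (g * h)).2 !mulgA -(mulgA (letter g)) E mul1g.
Qed.

Let ip_lift_letter u : ip (lift I u) = letter (eval id u).
Proof.
have l1 : letter 1 = 1.
  by rewrite -[LHS]mulg1 -(letterV 1).1 mulgA letterM mulg1.
elim: u => [|[g e] u IH]; first by rewrite eval_nil l1.
rewrite eval_cons -letterM -IH /= -cat1s ip_cat ip_eval eval1; congr (_ * _).
case: e; rewrite /eval_letter //=.
by rewrite -[RHS]mul1g -(letterV g).2 -mulgA letterM mulgV l1 mulg1.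
Qed.

Lemma cayley_adapted : adapted id c H cayley_relators.
Proof.
split=> //.
- by move=> u v [].
- move=> Y r YH [_ [[g [e rE]]|[i ci [g Hg rE]]|[g [h rE]]]];
    rewrite [r]rE {r rE}.
  + apply: (@sound_mulV _ _ _ id c H Y [:: (inl g, e)]) => z zv; split=> //; exact: zv.
  + apply: sound_mulV => z; apply: readable_conj => //; first exact: YH.
      exact: subgroup_mul.
    by rewrite eval1.
  + by apply: sound_lift; rewrite !eval_cons eval_nil mulg1 /eval_letter /= mulgA mulgV.
- by move=> u v uv; rewrite !ip_lift_letter uv.
- move=> i u ci Hu.
  have -> : ip (conj_word i u) = ip (conj_word i [:: (eval id u, false)]).
    by rewrite !ip_conj_word !ip_lift_letter eval1.
  rewrite -ipV -ip_cat; apply: relator; split=> //; apply: Or32.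
  by exists i => //; exists (eval id u).
- by move=> g; exists [:: (g, false)]; rewrite eval1.
Qed.

End CayleyPresentation.

Lemma invPres_morph_ext (A : choiceType) (R : set (word A * word A))
    (N : starMonoidType) (f f' : invPres R -> N) :
  inverse_monoid N -> monoid_morphism f -> monoid_morphism f' ->
  (forall a, f (igen R a) = f' (igen R a)) -> f = f'.
Proof.
move=> invN fm fm' ff'; apply/funext => x; have [w ->] := ip_surj x.
have invM := @invPres_inverse_monoid _ R.
have fV := inverse_morphV invM invN fm; have f'V := inverse_morphV invM invN fm'.
rewrite ip_eval (eval_morph _ fm fV) (eval_morph _ fm' f'V).
by congr (eval _ w); apply/funext.
Qed.

(** * Free product with the free inverse monoid of rank one *)

Section FreeProduct.
Variable G : groupType.

Notation R := (cayley_relators pred0 (fun _ : unit => [set (1 : G)])).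

Lemma cayley_free_adapted : adapted id pred0 (fun _ : unit => [set (1 : G)]) R.
Proof. by apply: cayley_adapted => // i; apply: subgroup1. Qed.

Lemma cayley_free_product :
  exists (i1 : G -> invPres R) (i2 : @invPres unit set0 -> invPres R),
    is_free_product i1 i2.
Proof.
have invM := @invPres_inverse_monoid _ R.
have [//|i2 [i2m i2E]] := @eval_extends _ set0 _ (fun u => igen R (inr u)) invM.
have i1E g : giota id R g = igen R (inl g) by rewrite (igen_inl cayley_free_adapted).
have i1m : monoid_morphism (giota id R).
  by split; [exact: (giota1 cayley_free_adapted)|exact: (giotaM cayley_free_adapted)].
exists (giota id R), i2; split=> // N f1 f2 invN f1m f2m.
have f1V := inverse_morphV (@group_inverse_monoid G) invN f1m.
pose h (a : G + unit) : N :=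
  match a with inl g => f1 g | inr u => f2 (igen set0 u) end.
have hR u v : R (u, v) -> eval h u = eval h v.
  move=> [/= ->]; rewrite eval_nil => -[[g [e ->]]|[]//|[g [k ->]]].
    rewrite !eval_cons eval_nil /eval_letter mulg1 /= -f1V.
    by case: e; rewrite /= -f1m.2 ?mulVg ?mulgV f1m.1.
  rewrite !eval_cons eval_nil /eval_letter /= mulg1 -f1V -!f1m.2.
  by rewrite mulgA mulgV f1m.1.
have [f [fm fE]] := eval_extends invN hR.
have fl g : f (igen R (inl g)) = f1 g by rewrite fE eval1.
have fr u : f (igen R (inr u)) = f2 (igen set0 u) by rewrite fE eval1.
have i2g u : i2 (igen set0 u) = igen R (inr u) by rewrite i2E eval1.
exists f; split.
  split=> // [g|x] /=; first by rewrite i1E fl.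
  suff -> : f2 = f \o i2 by [].
  apply: invPres_morph_ext => //; last by move=> u /=; rewrite i2g fr.
  by split=> [|y z] /=; rewrite ?i2m.1 ?fm.1 // i2m.2 fm.2.
move=> f' [f'm f'1 f'2]; apply: invPres_morph_ext => // -[g|u].
  by rewrite fl -i1E -[LHS]f'1.
by rewrite fr -i2g -[LHS]f'2.
Qed.

End FreeProduct.

(** * Finite presentations *)

(** If a product starting with an idempotent is 1, that idempotent is 1; so the factors [v v^-1] can
    be removed one by one. *)
Lemma right_unit_prefix (A : choiceType) (R : set (word A * word A))
    (V : seq (word A)) (r : word A) :
  \pi_(invPres R) (flatten [seq v ++ winv v | v <- V] ++ r) = 1 ->
  (forall v, v \in V ->
     \pi_(invPres R) v * (\pi_(invPres R) v)^-1 = 1) /\ \pi_(invPres R) r = 1.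
Proof.
have invM := @invPres_inverse_monoid _ R.
elim: V => [|v V IH] //=; rewrite -catA ip_cat ip_cat ipV => E.
have v1 := idem_right_unit (idem_mulV invM _) E.
move: E; rewrite v1 mul1g => /IH[VV r1]; split=> // u.
by rewrite inE => /predU1P[->|/VV].
Qed.

Lemma cat_separator_inj (T : eqType) (t : T) (u1 u2 v1 v2 : seq T) :
  t \notin u1 -> t \notin u2 ->
  u1 ++ t :: v1 = u2 ++ t :: v2 -> u1 = u2 /\ v1 = v2.
Proof.
elim: u1 u2 => [|x u1 IH] [|y u2] //=; rewrite ?inE ?negb_or.
- by move=> _ _ [->].
- by move=> _ /andP[/eqP ty _] [].
- by move=> /andP[/eqP tx _] _ [/esym].
- by move=> /andP[_ t1] /andP[_ t2] [-> /(IH _ t1 t2)[-> ->]].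
Qed.

Section FinitePresentation.
Variables (G : groupType) (B : choiceType) (phi : B -> G).
Variables (S : set (word B * word B)) (letters : seq B) (Y : seq G) (H : set G).
Hypothesis phi_gen : forall g, exists u, eval phi u = g.
Hypothesis phi_presents : forall u v,
  congr_gen (gp_rel S) u v <-> eval phi u = eval phi v.
Hypothesis lettersP : forall b, b \in letters.
Hypothesis H_gen : H = smallest (@subgroup G) [set` Y].
Hypothesis S_neq0 : S !=set0.

Let A : choiceType := (B + option bool)%type.

Let subH : subgroup H.
Proof.
rewrite H_gen; split=> [|g h].
  by apply/mem_set => K [[/set_mem K1 _] _].
move=> /set_mem gH /set_mem hH; apply/mem_set => K [KK YK].
apply: subgroup_mul => //; first exact: gH.
by apply: subgroup_inv => //; apply: hH.
Qed.

Let sub_peripheral o : subgroup (peripheral H o).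
Proof. by case: o => [a|] //; apply: subgroupT. Qed.

(** The empty word makes the letter itself a right unit. Inverses are listed because [conj_cat]
    provides closure under products only. *)
Definition peripheral_gens (o : option bool) : seq (word B) :=
  let us := if o is None then [seq gword phi y | y <- Y]
            else [seq [:: (b, false)] | b <- letters] in
  [::] :: us ++ [seq winv u | u <- us].

Definition right_units : seq (word A) :=
  [seq [:: (inl b, e)] | b <- letters, e <- [:: false; true]] ++
  [seq conj_word o u | o <- [:: None; Some true; Some false],
                       u <- peripheral_gens o].

Definition separator : word A := [:: (inr None, false); (inr None, true)].

(* One relator per relation u = v of the group: the prefix makes the words in
   right_units right invertible, and the separator, which is then trivial,
   makes distinct relations give distinct relators. *)
Definition relator (p : word B * word B) : word A :=
  flatten [seq v ++ winv v | v <- right_units] ++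
  lift _ p.1 ++ separator ++ lift _ (winv p.2).

Definition finite_relators : set (word A * word A) :=
  [set (relator p, [::]) | p in S].

Notation R := finite_relators.
Notation ip := (\pi_(invPres R)).

Lemma separator_notin u : ((inr None, false) : A * bool) \notin lift (option bool) u.
Proof. by apply/mapP => -[]. Qed.

Lemma lift_inj : injective (@lift B (option bool)).
Proof. by apply: inj_map => -[a e] [b d] [-> ->]. Qed.

(** The prefix is common to all relators, and the first separator letter does not occur in lifted
    words, so both sides of the relation can be read off. *)
Lemma finite_relators_card : R #= S.
Proof.
apply: inj_card_eq => -[u v] [u' v'] _ _ [] /eqP.
rewrite /relator eqseq_cat // => /andP[_ /eqP /cat_separator_inj].
case; rewrite ?separator_notin //= => /lift_inj ->.
by move=> [/lift_inj/(can_inj (@winvK _)) ->].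
Qed.

Lemma eval_gens_peripheral o u : u \in peripheral_gens o -> peripheral H o (eval phi u).
Proof.
have HY y : y \in Y -> H y by move=> yY; rewrite H_gen; apply: sub_gen_smallest.
case: o => [a|] //; rewrite !inE mem_cat => /orP[/eqP ->|/orP[]].
- by rewrite eval_nil; apply: subgroup_one.
- by case/mapP => y yY ->; rewrite eval_gword //; apply: HY.
- case/mapP => _ /mapP[y yY ->] ->; rewrite eval_winv eval_gword //.
  by apply: subgroup_inv => //; apply: HY.
Qed.

Lemma sound_right_units Z v : right_invariant (peripheral H) Z ->
  v \in right_units -> sound phi predT (peripheral H) Z (v ++ winv v).
Proof.
move=> ZH; rewrite mem_cat => /orP[/allpairsP[[b e] [_ _ ->]]|].
  by apply: sound_mulV => z zv; split=> //; exact: zv.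
case/allpairsPdep => o [u [_ uo ->]]; apply: sound_mulV => z.
apply: readable_conj => //; [exact: ZH|exact: subgroup_mul|].
exact: eval_gens_peripheral.
Qed.

Lemma sound_relator Z p : right_invariant (peripheral H) Z -> S p ->
  sound phi predT (peripheral H) Z (relator p).
Proof.
move=> ZH Sp; apply: sound_cat.
  apply: sound_flatten => _ /mapP[v vV ->]; exact: sound_right_units.
have E : eval phi p.1 = eval phi p.2.
  by apply/phi_presents/congr_base/gp_rel_relation; case: p Sp.
have sepE : separator = [:: (inr None, false)] ++ winv [:: (inr None, false)] by [].
rewrite sepE; split=> -[l g] zv.
  by rewrite act_cat act_cat !act_lift act_winv // act_lift eval_winv E mulgK.
apply/readable_cat; split; first exact/readable_lift.
rewrite act_lift; apply/readable_cat; split.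
  by apply/readable_mulV/readable1; split=> //; apply: valid_act_positive.
rewrite act_winv; last exact: valid_reduced zv.
exact/readable_lift.
Qed.

Let relator_units p : S p ->
  (forall v, v \in right_units -> ip v * (ip v)^-1 = 1) /\
  ip (lift _ p.1 ++ separator ++ lift _ (winv p.2)) = 1.
Proof.
move=> Sp; apply: right_unit_prefix; rewrite -pi_nil.
by apply: invPres_relation; exists p.
Qed.

(** Every relator carries the whole prefix, so a single relation in [S] suffices. *)
Let right_unitP v : v \in right_units -> ip v * (ip v)^-1 = 1.
Proof. by have [p /relator_units[+ _]] := S_neq0; apply. Qed.

Let letter_unit b e : ip [:: (inl b, e)] * ip [:: (inl b, ~~ e)] = 1.
Proof.
have -> : ip [:: (inl b, ~~ e)] = (ip [:: (inl b, e)])^-1 by rewrite -ipV.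
apply: right_unitP.
by rewrite mem_cat (allpairs_f (fun b e => [:: (inl b, e)])) //; case: e.
Qed.

Let lift_unit u : ip (lift _ (u ++ winv u)) = 1.
Proof.
elim: u => [|[b e] u IH] //.
rewrite winv_cons catA lift_cat ip_cat -cat1s -catA lift_cat ip_cat IH mulg1.
exact: letter_unit.
Qed.

Let conj_unit o u : u \in peripheral_gens o ->
  ip (conj_word o u) * (ip (conj_word o u))^-1 = 1.
Proof.
move=> uo; apply: right_unitP; rewrite mem_cat; apply/orP; right.
by apply: allpairs_f_dep => //; case: o uo => [[]|].
Qed.

Let tau_unit o : igen R (inr o) * (igen R (inr o))^-1 = 1.
Proof.
have := @conj_unit o [::]; rewrite inE => /(_ isT).
rewrite ip_conj_word pi_nil mulg1 invgM invgK => E.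
have invM := @invPres_inverse_monoid _ R.
by apply: (idem_right_unit (idem_mulV invM _) E).
Qed.

Let group_finite u v : eval phi u = eval phi v -> ip (lift _ u) = ip (lift _ v).
Proof.
move=> /phi_presents; elim=> {u v} [u v|//|u v _ //|u v w _ -> //|].
- case=> [w|{}u {}v Suv]; first exact: lift_unit.
  have [_] := relator_units Suv; rewrite !ip_cat.
  have -> : ip separator = 1.
    by rewrite /separator -cat1s -[X in _ ++ X]/(winv [:: (inr None, false)])
      ip_cat ipV tau_unit.
  rewrite mul1g /fst /snd => E.
  have := lift_unit (winv v); rewrite winvK lift_cat ip_cat => E'.
  by rewrite -[LHS]mulg1 -E' mulgA E mul1g.
- by move=> u u' v v' _ + _; rewrite !lift_cat !ip_cat => -> ->.
Qed.

(** The product of the two right units [t u t^-1] and [t v t^-1] lies below [t u v t^-1], and right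
    units are maximal. *)
Let conj_cat o u v : ip (conj_word o u) * (ip (conj_word o u))^-1 = 1 ->
  ip (conj_word o v) * (ip (conj_word o v))^-1 = 1 ->
  ip (conj_word o (u ++ v)) * (ip (conj_word o (u ++ v)))^-1 = 1.
Proof.
have invM := @invPres_inverse_monoid _ R.
move=> uU vU.
suff <- : ip (conj_word o u) * ip (conj_word o v) = ip (conj_word o (u ++ v)).
  exact: right_unitM.
apply: natural_le_right_unit; last exact: right_unitM.
rewrite !ip_conj_word lift_cat ip_cat.
have := natural_le_idem invM (igen R (inr o) * ip (lift _ u))
  (ip (lift _ v) * (igen R (inr o))^-1) (idem_Vmul invM (igen R (inr o))).
by rewrite !mulgA.
Qed.

(** Asking for all words of value [g] or [g^-1] builds closure under inversion into the
    definition. *)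
Let conj_units o : set G := [set g | forall u, eval phi u = g \/ eval phi u = g^-1 ->
  ip (conj_word o u) * (ip (conj_word o u))^-1 = 1].

Let conj_unitsE o u v : ip (conj_word o u) * (ip (conj_word o u))^-1 = 1 ->
  eval phi v = eval phi u -> ip (conj_word o v) * (ip (conj_word o v))^-1 = 1.
Proof. by rewrite !ip_conj_word => + /group_finite ->. Qed.

Let conj_units_subgroup o : subgroup (conj_units o).
Proof.
split=> [|g h /set_mem gK /set_mem hK]; apply/mem_set => u; rewrite ?invgF ?invg1.
  move=> u1; apply: (@conj_unitsE o [::]); first by apply: conj_unit; rewrite inE.
  by rewrite eval_nil; case: u1.
have [v vg] := phi_gen g; have [w wh] := phi_gen h.
case=> uE.
  apply: (@conj_unitsE o (v ++ winv w)); last by rewrite eval_cat eval_winv vg wh.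
  by apply: conj_cat; [apply: gK; left|apply: hK; right; rewrite eval_winv wh].
apply: (@conj_unitsE o (w ++ winv v)); last by rewrite eval_cat eval_winv vg wh.
by apply: conj_cat; [apply: hK; left|apply: gK; right; rewrite eval_winv vg].
Qed.

Let conj_units_gen o u : u \in peripheral_gens o -> winv u \in peripheral_gens o ->
  conj_units o (eval phi u).
Proof.
move=> uo uVo v [vE|vE]; first by apply: conj_unitsE vE; apply: conj_unit.
by apply: conj_unitsE (conj_unit uVo) _; rewrite eval_winv.
Qed.

Lemma peripheral_conj_units o g : peripheral H o g -> conj_units o g.
Proof.
case: o => [a _|] /=.
  have [u <-] := phi_gen g; elim: u => [|[b e] u IH].
    by rewrite eval_nil; apply: (subgroup_one (conj_units_subgroup _)).
  rewrite eval_cons; apply: (subgroup_mul (conj_units_subgroup _)) => //.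
  have bK : conj_units (Some a) (phi b).
    rewrite -[phi b](eval1 phi (b, false)); apply: conj_units_gen.
      by rewrite inE mem_cat (map_f (fun b => [:: (b, false)])).
    by rewrite inE mem_cat map_f ?orbT // (map_f (fun b => [:: (b, false)])).
  by rewrite /eval_letter; case: e => //=; apply: (subgroup_inv (conj_units_subgroup _)).
rewrite H_gen; apply: smallest_sub => // y yY.
rewrite -(eval_gword phi_gen y); apply: conj_units_gen.
  by rewrite inE mem_cat map_f ?orbT.
by rewrite inE mem_cat !map_f ?orbT.
Qed.

Lemma finite_adapted : adapted phi predT (peripheral H) R.
Proof.
split=> //.
- by move=> u v [p _ [_ <-]].
- by move=> Z r ZH [p Sp [<-]]; apply: sound_relator.
- by move=> o u _ /peripheral_conj_units; apply; left.
Qed.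

End FinitePresentation.

Lemma finite_special_inverse_monoid (G : groupType) (B : choiceType) (phi : B -> G)
    (S : set (word B * word B)) (H : set G) :
  (forall g, exists u, eval phi u = g) ->
  (forall u v, congr_gen (gp_rel S) u v <-> eval phi u = eval phi v) ->
  finite_set [set: B] -> finitely_generated H -> S !=set0 ->
  exists (A : choiceType) (R : set (word A * word A)),
    [/\ finite_set [set: A], R #= S, special R, E_unitary R &
        stabs_are_Hclasses H (invPres R)].
Proof.
move=> gen pres /finite_seqP[letters lettersE] [_ /finite_seqP[Y ->] HY] S0.
have lettersP b : b \in letters by have : [set: B] b by []; rewrite lettersE.
have adaptedR := finite_adapted gen pres lettersP HY S0.
exists (B + option bool)%type, (finite_relators phi S letters Y); split.
- apply/finite_seqP; exists ([seq inl b | b <- letters] ++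
    [seq inr o | o <- [:: None; Some true; Some false]]).
  apply/seteqP; split=> // -[b|o] _ /=; rewrite mem_cat ?map_f //.
  by apply/orP; right; case: o => [[]|]; rewrite !inE eqxx ?orbT.
- exact: finite_relators_card.
- exact: adapted_special adaptedR.
- exact: construction_E_unitary adaptedR.
- exact: stabs_peripheral adaptedR.
Qed.

(** * From abstract presentations to generating maps; finiteness of a basis *)

Lemma isomorphic_gpPres (G : groupType) (B : choiceType) (S : set (word B * word B)) :
  isomorphic (gpPres S) G -> exists phi : B -> G,
    (forall g, exists u, eval phi u = g) /\
    (forall u v, congr_gen (gp_rel S) u v <-> eval phi u = eval phi v).
Proof.
move=> [f [fbij fm]]; exists (f \o ggen S).
have fV := inverse_morphV (@group_inverse_monoid _) (@group_inverse_monoid _) fm.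
have fE u : eval (f \o ggen S) u = f (\pi_(gpPres S) u).
  by rewrite gp_eval (eval_morph _ fm fV).
case: fbij => f' f'K fK; split=> [g|u v].
  by exists (repr (f' g)); rewrite fE reprK fK.
by rewrite !fE; split=> [/wquotP -> //|/(can_inj f'K)/wquotP].
Qed.

Lemma congr_gen_mono (A : choiceType) (T T' : word A -> word A -> Prop) u v :
  (forall u v, T u v -> T' u v) -> congr_gen T u v -> congr_gen T' u v.
Proof.
move=> TT'; elim=> {u v}.
- by move=> u v /TT'; apply: congr_base.
- exact: congr_refl.
- by move=> u v _; apply: congr_sym.
- by move=> u v w _ uv _; apply: congr_trans uv.
- by move=> u u' v v' _ uu' _; apply: congr_cat uu'.
Qed.

(* A basis letter b0 outside the supports of finitely many generators would
   have odd exponent sum mod 2, whereas products of the generators do not. *)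
Lemma finite_basis (G : groupType) (B B' : choiceType) (phi : B -> G) (psi : B' -> G) :
  (forall g, exists u, eval phi u = g) -> (forall g, exists u, eval psi u = g) ->
  (forall u v, congr_gen (gp_rel set0) u v <-> eval psi u = eval psi v) ->
  finite_set [set: B] -> finite_set [set: B'].
Proof.
move=> genphi genpsi pres /finite_seqP[letters lettersE].
have lettersP b : b \in letters by have : [set: B] b by []; rewrite lettersE.
pose sub b := gword psi (phi b).
pose support := flatten [seq [seq p.1 | p <- sub b] | b <- letters].
apply/finite_seqP; exists support; apply/seteqP; split=> // b0 _ /=.
apply: contrapT => /negP b0N.
pose parity (w : word B') := odd (count (fun p => p.1 == b0) w).
have parity_cat u v : parity (u ++ v) = parity u (+) parity v.
  by rewrite /parity count_cat oddD.
have parity_winv w : parity (winv w) = parity w.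
  by rewrite /parity /winv count_rev count_map.
have parity_congr u v : congr_gen (gp_rel set0) u v -> parity u = parity v.
  elim=> {u v} [u v|//|u v _ //|u v w _ -> //|u u' v v' _ uu' _ vv'].
    by case=> // w; rewrite parity_cat parity_winv addbb.
  by rewrite !parity_cat uu' vv'.
have parity_sub b : parity (sub b) = false.
  apply/negbTE/negP => odd_b; case/negP: b0N.
  have /hasP[p pb /eqP <-] : has (fun p => p.1 == b0) (sub b).
    by rewrite has_count; move: odd_b; rewrite /parity; case: (count _ _).
  by apply/flattenP; exists [seq p.1 | p <- sub b]; apply: map_f.
(* Each letter of [u] is replaced by its expression over the basis, which avoids [b0]. *)
have even u : exists2 w, eval psi w = eval phi u & parity w = false.
  elim: u => [|[b e] u [w wu w0]]; first by exists [::]; rewrite ?eval_nil.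
  exists ((if e then winv (sub b) else sub b) ++ w).
    rewrite eval_cat eval_cons wu /eval_letter /=.
    by case: e; rewrite ?eval_winv (eval_gword genpsi).
  by rewrite parity_cat w0; case: e; rewrite ?parity_winv parity_sub.
have [u ub0] := genphi (eval psi [:: (b0, false)]).
have [w wu] := even u; rewrite ub0 in wu.
by rewrite (parity_congr _ _ ((pres _ _).2 wu)) /parity /= eqxx.
Qed.

Theorem theorem5p3 (G : groupType) (H : set G) (subH : subgroup H) :
  [/\ exists (A : choiceType) (R : set (word A * word A)),
        [/\ special R, E_unitary R & stabs_are_Hclasses H (invPres R)],
      forall (B : choiceType) (S : set (word B * word B)) (k : nat),
        finite_set [set: B] -> S #= `I_k -> isomorphic (gpPres S) G ->
        finitely_generated H ->
        exists (A : choiceType) (R : set (word A * word A)),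
          [/\ finite_set [set: A],
              R #= `I_(if `[< is_free_group G >] then 1%N else k),
              special R, E_unitary R & stabs_are_Hclasses H (invPres R)]
    & H = [set 1] ->
        exists (A : choiceType) (R : set (word A * word A)),
          [/\ special R, E_unitary R, stabs_are_Hclasses H (invPres R) &
              exists (B : choiceType) (i1 : G -> invPres R)
                     (i2 : @invPres B set0 -> invPres R),
                is_free_product i1 i2]].
Proof.
split.
- have adaptedR : adapted id predT (peripheral H)
      (cayley_relators predT (peripheral H)).
    by apply: cayley_adapted => // -[a|] //; apply: subgroupT.
  exists (G + option bool)%type, (cayley_relators predT (peripheral H)); split.
  + exact: adapted_special adaptedR.
  + exact: construction_E_unitary adaptedR.
  + exact: stabs_peripheral adaptedR.
- move=> B S k finB Sk isoG fgH.
  have [phi [gen pres]] := isomorphic_gpPres isoG.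
  case: asboolP => [[B' isoG']|notfree].
    have [psi [gen' pres']] := isomorphic_gpPres isoG'.
    have finB' := finite_basis gen gen' pres' finB.
    (* A basis needs no relations; the trivial relation [1 = 1] is added so that one relator exists
       to carry the prefix. *)
    have pres1 u v :
        congr_gen (gp_rel [set ([::], [::])]) u v <-> eval psi u = eval psi v.
      split=> [|/pres']; first by apply: eval_congr_gp => _ _ [-> ->].
      apply: congr_gen_mono => _ _ [w|x y //]; exact: gp_rel_cancel.
    have [|A [R [finA Rcard sR uR stR]]] :=
        finite_special_inverse_monoid gen' pres1 finB' fgH.
      by exists ([::], [::]).
    by exists A, R; split=> //; apply: card_eq_trans Rcard card_set1.
  have [|A [R [finA Rcard sR uR stR]]] :=
      finite_special_inverse_monoid gen pres finB fgH.
    (* An empty [S] would present a free group. *)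
    by apply/set0P/eqP => S0; apply: notfree; exists B; rewrite -S0.
  by exists A, R; split=> //; apply: card_eq_trans Rcard Sk.
- move=> ->; have adaptedR := cayley_free_adapted G.
  exists (G + unit)%type, (cayley_relators pred0 (fun _ : unit => [set (1 : G)])).
  split.
  + exact: adapted_special adaptedR.
  + exact: construction_E_unitary adaptedR.
  + exact: stabs_free adaptedR.
  + by exists unit; apply: cayley_free_product.
Qed.
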